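(* Let $X$ be a special (abstract) rank one group with unipotent subgroups $A$ and $B$ (arbitrary, in particular not assumed to be nilpotent), and suppose that the unipotent subgroups have size at least $4$, i.e. $|A| \geq 4$ and $|B| \geq 4$ (infinite cardinalities allowed). Then $X$ is perfect, i.e. $X = [X,X]$.
   Context: For a subgroup $A$ of a group $X$ and $x \in X$ write $A^x = x^{-1}Ax$. A group $X$ is an (abstract) rank one group with unipotent subgroups $A$ and $B$ if $A$ and $B$ are different subgroups of $X$ with $X = \langle A, B\rangle$, and: for each $1 \neq a \in A$ there is an element $1 \neq b \in B$ such that $A^b = B^a$; and vice versa, for each $1 \neq b \in B$ there is an element $1 \neq a \in A$ such that $A^b = B^a$. It is not assumed that $A$ and $B$ are nilpotent. In such a group, for each $1 \neq a \in A$ the element $1 \neq b \in B$ with $A^b = B^a$ is uniquely determined and is denoted by $b(a)$. The group $X$ (with $A$, $B$) is called special if $b(a^{-1}) = b(a)^{-1}$ for all $1 \neq a \in A$. *)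

(* Defs.v *)
From mathcomp Require Import all_boot.
From mathcomp Require Import boolp classical_sets cardinality.

Set Implicit Arguments.
Unset Strict Implicit.
Unset Printing Implicit Defensive.

Local Open Scope classical_set_scope.
Local Open Scope group_scope.

(* [groupType] covers arbitrary, possibly infinite groups; its subgroups are
   handled as Prop-valued sets, so that no decidability is imposed on them. *)

Definition is_subgroup (X : groupType) (H : set X) : Prop :=
  group_closed (mem H).

Definition generated (X : groupType) (S : set X) : set X :=
  smallest (@is_subgroup X) S.

(* H^x = x^-1 H x; recall that [h ^ x] is [x^-1 * (h * x)] on elements. *)
Definition conjugate (X : groupType) (H : set X) (x : X) : set X :=
  [set h ^ x | h in H].

Definition commutator_subgroup (X : groupType) (H K : set X) : set X :=
  generated [set [~ h, k] | h in H & k in K].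

Definition perfect (X : groupType) : Prop :=
  [set: X] = commutator_subgroup [set: X] [set: X].

Record rank_one_group (X : groupType) (A B : set X) : Prop := RankOneGroup {
  rank_one_subgroupl : is_subgroup A;
  rank_one_subgroupr : is_subgroup B;
  rank_one_neq : A <> B;
  rank_one_gen : [set: X] = generated (A `|` B);
  rank_one_lr : forall a, A a -> a <> 1 ->
    exists b, [/\ B b, b <> 1 & conjugate A b = conjugate B a];
  rank_one_rl : forall b, B b -> b <> 1 ->
    exists a, [/\ A a, a <> 1 & conjugate A b = conjugate B a]
}.

(* The element b(a). The default value 1 is only used when there is no such
   element, which cannot happen for 1 <> a in A in a rank one group; see
   [rank_one_bP] and [rank_one_b_unique]. *)
Definition rank_one_b (X : groupType) (A B : set X) (a : X) : X :=
  xget 1 [set b | [/\ B b, b <> 1 & conjugate A b = conjugate B a]].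

Definition special (X : groupType) (A B : set X) : Prop :=
  forall a, A a -> a <> 1 ->
    rank_one_b A B a^-1 = (rank_one_b A B a)^-1.

Lemma rank_one_bP (X : groupType) (A B : set X) (a : X) :
  rank_one_group A B -> A a -> a <> 1 ->
  [/\ B (rank_one_b A B a), rank_one_b A B a <> 1
    & conjugate A (rank_one_b A B a) = conjugate B a].
Proof.
move=> r1 Aa a1; have [b Pb] := rank_one_lr r1 Aa a1.
exact: (@xgetI _ 1 [set b | [/\ B b, b <> 1 & conjugate A b = conjugate B a]] b).
Qed.

Lemma is_subgroupP (X : groupType) (H : set X) :
  is_subgroup H <-> H 1 /\ forall x y, H x -> H y -> H (x / y).
Proof.
rewrite /is_subgroup /group_closed; split=> -[H1 Hdiv]; split.
- by move: H1; rewrite inE.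
- by move=> x y Hx Hy; apply/set_mem; apply: Hdiv; rewrite ?inE.
- by rewrite inE.
- by move=> x y; rewrite !inE => Hx Hy; apply: Hdiv.
Qed.

Lemma conjugateM (X : groupType) (H : set X) (x y : X) :
  conjugate (conjugate H x) y = conjugate H (x * y).
Proof.
rewrite /conjugate image_comp; apply: eq_imagel => h _ /=.
by rewrite conjgM.
Qed.

Lemma conjugate1 (X : groupType) (H : set X) : conjugate H 1 = H.
Proof.
rewrite /conjugate -[RHS]image_id; apply: eq_imagel => h _.
by rewrite conjg1.
Qed.

Lemma conjugate_id (X : groupType) (H : set X) (x : X) :
  is_subgroup H -> H x -> conjugate H x = H.
Proof.
move=> /is_subgroupP[H1 Hdiv] Hx.
have HV y : H y -> H y^-1 by move=> Hy; rewrite -[y^-1]mul1g; apply: Hdiv.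
have HM y z : H y -> H z -> H (y * z).
  by move=> Hy Hz; rewrite -[z]invgK; apply: Hdiv => //; apply: HV.
apply/seteqP; split=> [_ [h Hh <-]|h Hh].
  by rewrite /conjg; apply: (HM) => //; [apply: HV|apply: HM].
exists (h ^ x^-1); last by rewrite conjgKV.
by rewrite /conjg invgK; apply: (HM) => //; apply: HM => //; apply: HV.
Qed.

Lemma rank_one_b_unique (X : groupType) (A B : set X) (a b : X) :
  rank_one_group A B -> A a -> a <> 1 ->
  B b -> conjugate A b = conjugate B a -> b = rank_one_b A B a.
Proof.
move=> r1 Aa a1 Bb Ab; have [Bb' _ Ab'] := rank_one_bP r1 Aa a1.
set b' := rank_one_b A B a in Bb' Ab' *.
have [sA sB] := (rank_one_subgroupl r1, rank_one_subgroupr r1).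
have Bc : B (b / b') by have [_] := (is_subgroupP B).1 sB; apply.
have Ac : conjugate A (b / b') = A.
  by rewrite -conjugateM Ab -Ab' conjugateM mulgV conjugate1.
have [c1|/eqP/(rank_one_rl r1 Bc)[a' [Aa' _]]] := eqVneq (b / b') 1.
  by rewrite -[b](mulgVK b') c1 mul1g.
rewrite Ac => AB; case: (rank_one_neq r1).
have -> : B = conjugate A a'^-1.
  by rewrite AB conjugateM mulgV conjugate1.
rewrite conjugate_id //; have [A1 Adiv] := (is_subgroupP A).1 sA.
by rewrite -[a'^-1]mul1g; apply: Adiv.
Qed.

(* Main.v *)
Require Import Defs.
From mathcomp Require Import all_boot.
From mathcomp Require Import boolp classical_sets cardinality.
From Stdlib Require Import Morphisms.

Local Open Scope classical_set_scope.
Local Open Scope card_scope.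

(** Writing [n = c b(c)^-1 c], which interchanges [A] and [B], one has
    [b(c) = c n^-1 c], and comparing the images of the point [A] gives
    [b(a) b(c) = b(d)] with [d = b(ac)^(n^-1) c], whenever [ac <> 1].  On the
    other hand [a] is conjugate to [b(a)^-1], so modulo [[X, X]] the first
    equation reads [d = ac] and the second one [d = a^-1].  By symmetry
    [a = a^-1 c^-1 = c] in the abelianization, for all nontrivial [a], [c] in
    [A] with [ac <> 1].  If [|A| >= 4], then given [c <> 1] choose [a] outside
    of [{1, c, c^-1}]: both [a] and [a c^-1] have the same image as [c], so
    [c] has trivial image. *)

Local Open Scope group_scope.

Set Implicit Arguments.
Unset Strict Implicit.
Unset Printing Implicit Defensive.

Section Subgroups.
Variables (X : groupType) (H : set X).
Hypothesis sH : is_subgroup H.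

Lemma subgroup1 : H 1.
Proof. by have [] := (is_subgroupP H).1 sH. Qed.

Lemma subgroupV x : H x -> H x^-1.
Proof.
have [H1 Hdiv] := (is_subgroupP H).1 sH.
by move=> Hx; rewrite -[x^-1]mul1g; apply: Hdiv.
Qed.

Lemma subgroupM x y : H x -> H y -> H (x * y).
Proof.
have [_ Hdiv] := (is_subgroupP H).1 sH.
by move=> Hx Hy; rewrite -[y]invgK; apply: Hdiv => //; apply: subgroupV.
Qed.

End Subgroups.

Lemma generated_subgroup (X : groupType) (S : set X) :
  is_subgroup (generated S).
Proof.
apply/is_subgroupP; split=> [K [sK _]|x y Kx Ky K SK]; first exact: subgroup1.
have [sK _] := SK; have [_ Kdiv] := (is_subgroupP K).1 sK.
by apply: Kdiv; [apply: Kx|apply: Ky].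
Qed.

Lemma invg_neq1 (X : groupType) (x : X) : x <> 1 -> x^-1 <> 1.
Proof. by move=> x1 xV1; apply: x1; rewrite -[x]invgK xV1 invg1. Qed.

(** If [A] were contained in [s], [index^~ s] would inject it into a set of [size s] elements, fewer
    than [n]. *)
Lemma card_ge_notin (T : choiceType) (A : set T) (n : nat) (s : seq T) :
  `I_n #<= A -> size s < n -> exists2 a, A a & a \notin s.
Proof.
move=> leA s_lt; apply: contrapT => nA.
have As a : A a -> a \in s.
  by move=> Aa; apply: contrapT => /negP ?; apply: nA; exists a.
suff : `I_n #<= `I_(size s) by rewrite card_le_II leqNgt s_lt.
apply: card_le_trans leA _; apply/pcard_leP/injfunPex.
exists (index^~ s) => [a /As|a c]; first by rewrite /= index_mem.
move=> /set_mem/As a_s /set_mem/As c_s /(congr1 (nth a s)).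
by rewrite !nth_index.
Qed.

Section Abelianization.
Variable X : groupType.

Let D : set X := commutator_subgroup [set: X] [set: X].

Let sD : is_subgroup D.
Proof. exact: generated_subgroup. Qed.

Let commD (x y : X) : D [~ x, y].
Proof. by move=> K [_]; apply; exists x => //; exists y. Qed.

(** Equality in the abelianization, kept as a relation on [X] so that rewriting modulo [X, X] needs
    no quotient group. *)
Definition eqab (x y : X) : Prop := D (x * y^-1).

Lemma eqab1 x : eqab x 1 <-> D x.
Proof. by rewrite /eqab invg1 mulg1. Qed.

#[global] Instance eqab_equivalence : Equivalence eqab.
Proof.
split=> [x|x y xy|x y z xy yz]; rewrite /eqab.
- by rewrite mulgV; exact: subgroup1 sD.
- by rewrite -[y * _]invgK invgM invgK; exact: (subgroupV sD).
- by rewrite -[x](mulgVK y) -mulgA; exact: (subgroupM sD).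
Qed.

Lemma eqabC x y : eqab (x * y) (y * x).
Proof. by rewrite /eqab (commgCV x y) mulgK; apply: commD. Qed.

#[global] Instance eqab_mul : Proper (eqab ==> eqab ==> eqab) *%g.
Proof.
move=> x x' xx' y y' yy'; rewrite /eqab.
have -> : x * y * (x' * y')^-1 = (y * y'^-1) ^ x^-1 * (x * x'^-1).
  by rewrite conjgE invgK invgM !mulgA mulgVK.
(* Normality of [D]: z ^ g = z [z, g]. *)
apply: (subgroupM sD) => //; rewrite -[_ ^ _](mulVKg (y * y'^-1)) -commgEl.
exact: (subgroupM sD).
Qed.

#[global] Instance eqab_inv : Proper (eqab ==> eqab) (@monoid.inv X).
Proof.
move=> x y xy; rewrite /eqab -eqab1 eqabC invgK eqab1.
by change (eqab y x); symmetry.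
Qed.

Lemma eqabJ x y : eqab (x ^ y) x.
Proof. by rewrite conjgE eqabC mulgK; reflexivity. Qed.

End Abelianization.

Section RankOne.
Variables (X : groupType) (A B : set X).
Hypotheses (r1 : rank_one_group A B) (spec : special A B).

Local Notation b := (rank_one_b A B).

Let sA := rank_one_subgroupl r1.
Let sB := rank_one_subgroupr r1.

Let bP a : A a -> a <> 1 -> conjugate A (b a) = conjugate B a.
Proof. by move=> Aa a1; have [] := rank_one_bP r1 Aa a1. Qed.

(** By speciality, b(a)^-1 is the element attached to a^-1. *)
Let bVP a : A a -> a <> 1 -> conjugate A (b a)^-1 = conjugate B a^-1.
Proof.
by move=> Aa a1; rewrite -spec // bP //; [exact: subgroupV|exact: invg_neq1].
Qed.

Let Bb a : A a -> a <> 1 -> B (b a).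
Proof. by move=> Aa a1; have [] := rank_one_bP r1 Aa a1. Qed.

(* The element [b(a)^-1 a b(a)^-1] interchanges [A] and [B] and conjugates [a]
   to [b(a)^-1]. *)
Lemma eqab_rank_one_b a : A a -> a <> 1 -> eqab (b a) a^-1.
Proof.
move=> Aa a1; have Ba := Bb Aa a1; set m := (b a)^-1 * a * (b a)^-1.
have Am : conjugate A m = B.
  rewrite -!conjugateM bVP // (conjugateM B) mulVg conjugate1.
  by apply: conjugate_id => //; exact: subgroupV.
have Bm : conjugate B m = A.
  rewrite -!conjugateM [conjugate B _]conjugate_id //; last exact: subgroupV.
  by rewrite -bP // conjugateM mulgV conjugate1.
(* By uniqueness of b(a^-1), it suffices that a ^ m lies in A^m = B and that A^(a ^ m) =
   B^(a^-1). *)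
have amE : a ^ m = (b a)^-1.
  rewrite -spec //; apply: rank_one_b_unique => //.
  - exact: subgroupV.
  - exact: invg_neq1.
  - by rewrite -Am; exists a.
  have AmV : conjugate A m^-1 = B by rewrite -Bm conjugateM mulgV conjugate1.
  have bm : b a * m = a * (b a)^-1 by rewrite /m !mulgA mulgV mul1g.
  rewrite conjgE -conjugateM AmV -conjugateM -bP // conjugateM bm -conjugateM.
  by rewrite (conjugate_id sA Aa) bVP.
by rewrite -[b a]invgK -amE eqabJ; reflexivity.
Qed.

Lemma rank_one_bM a c : A a -> a <> 1 -> A c -> c <> 1 -> a * c <> 1 ->
  let d := b (a * c) ^ (c * (b c)^-1 * c)^-1 * c in
  [/\ A d, d <> 1 & b d = b a * b c].
Proof.
move=> Aa a1 Ac c1 ac1; set n := c * _ * c => d.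
have Bac : B (b a * b c) by apply: subgroupM => //; exact: Bb.
have Aac : A (a * c) by exact: subgroupM.
have An : conjugate A n = B.
  rewrite -!conjugateM [conjugate A c]conjugate_id // bVP //.
  by rewrite conjugateM mulVg conjugate1.
have Bn : conjugate B n = A.
  rewrite -!conjugateM -bP // (conjugateM A) mulgV conjugate1.
  exact: conjugate_id.
have BnV : conjugate B n^-1 = A by rewrite -An conjugateM mulgV conjugate1.
have Ad : A d.
  apply: subgroupM => //.
  suff : conjugate B n^-1 (b (a * c) ^ n^-1) by rewrite BnV.
  by exists (b (a * c)) => //; exact: Bb.
(* As b(c) = c n^-1 c, the left side is B^(a c n^-1 c) = A^(b(ac) n^-1 c), and A = B^n turns this
   into B^(n b(ac) n^-1 c). *)
have dE : conjugate A (b a * b c) = conjugate B d.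
  have -> : d = n * (b (a * c) * (n^-1 * c)).
    by rewrite /d conjgE invgK !mulgA.
  have bcE : b c = c * (n^-1 * c).
    by rewrite /n !invgM invgK !mulgA mulgV mul1g mulgVK.
  rewrite -(conjugateM B n) Bn -(conjugateM A (b (a * c))) bP //.
  by rewrite -(conjugateM A (b a)) bP // bcE !conjugateM mulgA.
(* Otherwise an element of [B] conjugates [A] to [B], forcing A = B. *)
have d1 : d <> 1.
  move=> d1; case: (rank_one_neq r1); move: dE; rewrite d1 conjugate1 => AB.
  rewrite -[A]conjugate1 -(mulgV (b a * b c)) -conjugateM AB.
  by rewrite conjugate_id //; exact: subgroupV.
by split=> //; symmetry; exact: rank_one_b_unique.
Qed.

Lemma eqab_unipotent a c :
  A a -> a <> 1 -> A c -> c <> 1 -> a * c <> 1 -> eqab a c.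
Proof.
(* Evaluate b(d) = b(x) b(y) modulo [X, X]: the right side gives x^-1 y^-1, while d becomes (xy)^-1
   y, a conjugate of x^-1, so b(d) becomes x. *)
have half x y : A x -> x <> 1 -> A y -> y <> 1 -> x * y <> 1 ->
    eqab x (x^-1 * y^-1).
  move=> Ax x1 Ay y1 xy1; have [Ad d1 bd] := rank_one_bM Ax x1 Ay y1 xy1.
  have Axy := subgroupM sA Ax Ay.
  rewrite -(eqab_rank_one_b Ax) // -(eqab_rank_one_b Ay) // -bd.
  rewrite eqab_rank_one_b // eqabJ eqab_rank_one_b // (invgM x) -mulgA -conjgE.
  by rewrite eqabJ invgK; reflexivity.
(* Modulo [X, X] the value a^-1 c^-1 is symmetric in a and c. *)
move=> Aa a1 Ac c1 ac1; rewrite (half a c) // eqabC -half //; first reflexivity.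
by move=> ca1; apply: ac1; rewrite -[c](mulgK a) ca1 mul1g mulgV.
Qed.

End RankOne.

Theorem theorem1p1 (X : groupType) (A B : set X)
  (rank_oneX : rank_one_group A B)
  (specialX : special A B)
  (leA : `I_4 #<= A) (leB : `I_4 #<= B) :
  perfect X.
Proof.
have [sA sB] := (rank_one_subgroupl rank_oneX, rank_one_subgroupr rank_oneX).
have A1 c : A c -> eqab c 1.
  move=> Ac; have [->|/eqP c1] := eqVneq c 1; first reflexivity.
  (* Avoiding c^-1 makes the pair (a, c) admissible; avoiding c and 1 does so for (a c^-1, c), whose
     product is a. *)
  have [a Aa] := card_ge_notin (s := [:: 1; c; c^-1]) leA isT.
  rewrite !inE !negb_or => /and3P[/eqP a1 /eqP ac /eqP acV].
  have a_c : eqab a c.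
    apply: (eqab_unipotent rank_oneX specialX) => // ac1.
    by apply: acV; rewrite -[a](mulgK c) ac1 mul1g.
  have : eqab (a * c^-1) c.
    apply: (eqab_unipotent rank_oneX specialX) => //.
    - exact: (subgroupM sA Aa (subgroupV sA Ac)).
    - by move=> ac1; apply: ac; rewrite -[a](mulgVK c) ac1 mul1g.
    - by rewrite mulgVK.
  by rewrite a_c mulgV => c_1; symmetry.
(* Since b ^ a lies in B^a = A^b, b is conjugate to an element of [A]. *)
have B1 b : B b -> eqab b 1.
  move=> Bb; have [->|/eqP b1] := eqVneq b 1; first reflexivity.
  have [a [_ _ AbBa]] := rank_one_rl rank_oneX Bb b1.
  have : conjugate B a (b ^ a) by exists b.
  rewrite -AbBa => -[c Ac cE].
  by rewrite -(eqabJ b a) -cE eqabJ; exact: A1.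
apply/seteqP; split=> // x _.
have : generated (A `|` B) x by rewrite -(rank_one_gen rank_oneX).
apply: (smallest_sub (generated_subgroup _)).
by move=> y [/A1|/B1] /eqab1.
Qed.
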